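(* The Erdős--Straus conjecture holds for a proportion of integers tending to $1$: the set of integers $n \ge 2$ for which there exist positive integers $x,y,z$ with \[ \frac{4}{n} = \frac{1}{x} + \frac{1}{y} + \frac{1}{z} \] has natural density $1$, i.e. \[ \lim_{X \to +\infty} \frac{1}{X}\left|\left\{ 2 \le n \le X : \exists\, x,y,z \in \mathbb{N}^*,\ \frac{4}{n} = \frac{1}{x} + \frac{1}{y} + \frac{1}{z} \right\}\right| = 1. \]
   Context: $\mathbb{N}^*$ denotes the set of positive integers. The Erdős--Straus conjecture asserts that for every integer $n \ge 2$ there exist positive integers $x,y,z$ with $\frac{4}{n} = \frac{1}{x} + \frac{1}{y} + \frac{1}{z}$. *)

(* Defs.v *)
From mathcomp Require Import all_boot all_order all_algebra.
From mathcomp Require Import all_classical all_reals all_analysis.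
Set Implicit Arguments.
Unset Strict Implicit.
Unset Printing Implicit Defensive.
Import Order.TTheory GRing.Theory Num.Theory.
Local Open Scope ring_scope.

Definition erdos_straus (n : nat) : Prop :=
  exists x y z : nat,
    [/\ (0 < x)%N, (0 < y)%N, (0 < z)%N &
        4 / n%:R = 1 / x%:R + 1 / y%:R + 1 / z%:R :> rat].

(* Main.v *)
Require Import Defs.
From mathcomp Require Import all_boot all_order all_algebra finmap.
From mathcomp Require Import all_classical all_reals all_analysis.
From mathcomp Require Import ring lra zify.
Set Implicit Arguments.
Unset Strict Implicit.
Unset Printing Implicit Defensive.
Import Order.TTheory GRing.Theory Num.Theory.
Import numFieldNormedType.Exports.
Local Open Scope classical_set_scope.
Local Open Scope ring_scope.

(** If p = 3 mod 4 divides n = p m and p + 1 = 4 k, then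
    4/n = 1/(2 k m) + 1/(2 k m) + 1/(p k m).  So, for P a product of primes that
    are 3 mod 4, exceptions are coprime to P and have upper density at most
    phi(P)/P.  To make phi(P)/P small without Dirichlet's theorem, start from
    the nonprincipal character chi mod 4, whose sums of chi(n)/n lie in [0, 1],
    and flip the sign of chi at each prime p = 3 mod 4, p <= y.  Each flip
    multiplies the bound on these sums by at most (p/(p-1))^2, hence the last
    bound is (P/phi(P))^2; but the final function is 1 at every odd n <= y,
    so its sum up to y is unbounded as y grows. *)

(** * Solvable multiples of primes 3 mod 4, and counting integers coprime to P *)

Lemma erdos_straus_dvd p n : (p %% 4 = 3)%N -> (p %| n)%N -> (0 < n)%N ->
  erdos_straus n.
Proof.
move=> p3 /dvdnP[m ->]; rewrite muln_gt0 => /andP[m_gt0 p_gt0].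
have [k kE] : exists k, p.+1 = (4 * k)%N by exists (p %/ 4).+1; lia.
have k_gt0 : (0 < k)%N by lia.
exists (2 * k * m)%N, (2 * k * m)%N, (p * k * m)%N.
split; [by rewrite !muln_gt0 ?k_gt0 ?m_gt0 ?p_gt0.. |].
have m0 : (m%:R : rat) != 0 by rewrite pnatr_eq0 -lt0n.
have k0 : (k%:R : rat) != 0 by rewrite pnatr_eq0 -lt0n.
have p0 : (p%:R : rat) != 0 by rewrite pnatr_eq0 -lt0n.
have pE : p%:R = 4 * k%:R - 1 :> rat by rewrite -natrM -kE -natr1 addrK.
rewrite !natrM pE; rewrite pE in p0.
by field; rewrite ?m0 ?k0 ?p0.
Qed.

(** Each block of P consecutive integers holds exactly [totient P] coprime ones, and [M %/ P] + 1
    blocks cover the range. *)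
Lemma count_coprime_le (P M : nat) : (0 < P)%N ->
  (\sum_(0 <= n < M) coprime P n <= (M %/ P).+1 * totient P)%N.
Proof.
move=> P_gt0.
have period k : (\sum_(0 <= n < k * P) coprime P n = k * totient P)%N.
  elim: k => [|k IHk]; first by rewrite !mul0n big_geq.
  rewrite mulSnr (@big_cat_nat _ _ _ (k * P)%N) ?leq_addr //= IHk mulSnr.
  congr addn; rewrite totient_count_coprime -{1}[(k * P)%N]add0n big_addn addKn.
  by apply: eq_bigr => i _; rewrite /coprime addnC gcdnMDl.
rewrite -period.
have leM : (M <= (M %/ P).+1 * P)%N by rewrite ltnW // ltn_ceil.
by rewrite [leqRHS](@big_cat_nat _ _ _ M) //= leq_addr.
Qed.

(** * Effect on harmonic sums of a sign flip at one prime *)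

Section HarmonicTwist.
Variable R : realType.
Implicit Types (a b c : nat -> R) (p m n N y : nat) (Q : seq nat).

Definition harmonic_sum a N : R := \sum_(1 <= n < N.+1) a n / n%:R.

Lemma harmonic_sum_dvd a p N : (0 < p)%N ->
  \sum_(1 <= n < N.+1 | (p %| n)%N) a (n %/ p)%N / n%:R =
  harmonic_sum a (N %/ p) / p%:R.
Proof.
rewrite /harmonic_sum => p_gt0; elim: N => [|N IHN].
  by rewrite div0n !big_geq // mul0r.
rewrite big_mkcond big_nat_recr //= -big_mkcond /= IHN divnS //.
case: (boolP (p %| N.+1)%N) => [/dvdnP[q qE] | _]; last by rewrite addr0.
have q_gt0 : (0 < q)%N by move: qE; case: q.
have qN : (N %/ p).+1 = q.
  by have := divnS N p_gt0; rewrite qE dvdn_mull // mulnK // => ->.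
rewrite [RHS]/= add1n [in RHS]big_nat_recr //= qN qE mulrDl natrM.
by rewrite invfM mulrA.
Qed.

(* The hypotheses say that the Dirichlet series of b is that of a multiplied by
   (1 + p^-s) / (1 - p^-s). *)
Lemma harmonic_sum_twist a b p (C : R) : (1 < p)%N ->
  (forall n, ~~ (p %| n)%N -> b n = a n) ->
  (forall n, (0 < n)%N -> a (p * n)%N = - a n) ->
  (forall n, (0 < n)%N -> b (p * n)%N = b n) ->
  (forall N, `|harmonic_sum a N| <= C) ->
  forall N, `|harmonic_sum b N| <= C * (p%:R / p.-1%:R) ^+ 2.
Proof.
move=> p_gt1 ba apN bpN aC; elim/ltn_ind=> N IHN.
have p_gt0 : (0 < p)%N by lia.
have p1R : (1 : R) < p%:R by rewrite ltr1n.
have pR : p.-1%:R = p%:R - 1 :> R by rewrite -{2}(prednK p_gt0) -natr1 addrK.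
set D := C * _ in IHN *.
have C0 : 0 <= C by apply: le_trans (aC 0%N).
(* The bound [D] closes the recursion: D(1 - 1/p) = C p/(p-1), which exceeds C(1 + 1/p) by
   C/(p(p-1)). *)
have CD : C + C / p%:R + D / p%:R <= D.
  have : 0 < (p%:R : R) - 1 by lra.
  rewrite /D pR => q0; rewrite -subr_ge0.
  have -> : C * (p%:R / (p%:R - 1)) ^+ 2 - (C + C / p%:R +
     C * (p%:R / (p%:R - 1)) ^+ 2 / p%:R) = C / (p%:R * (p%:R - 1)) :> R.
    by field; apply/andP; split; lra.
  by rewrite divr_ge0 // mulr_ge0 //; lra.
(* This is (1 - p^-s) B(s) = (1 + p^-s) A(s) read on coefficients: at n = p m, a(n) + a(m) = 0 and
   b(n) = b(m). *)
have E : harmonic_sum b N = harmonic_sum a N + harmonic_sum a (N %/ p) / p%:R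
   + harmonic_sum b (N %/ p) / p%:R.
  rewrite -!harmonic_sum_dvd // /harmonic_sum [X in _ + X + _]big_mkcond.
  rewrite [X in _ + _ + X]big_mkcond -!big_split /=; apply: eq_big_nat => n /andP[n_gt0 _].
  case: ifPn => [/dvdnP[m nE] | /ba ->]; last by rewrite !addr0.
  have m_gt0 : (0 < m)%N by lia.
  rewrite nE mulnK // [(m * p)%N]mulnC apN // bpN //.
  by ring.
case: N IHN E => [|N] IHN E.
  by rewrite /harmonic_sum big_geq // normr0 /D mulr_ge0 // exprn_ge0 // divr_ge0.
rewrite E; apply: le_trans CD; apply: le_trans (ler_normD _ _) _.
have ip : `|(p%:R : R)^-1| = p%:R^-1 by rewrite ger0_norm // invr_ge0; lra.
apply: lerD; first apply: le_trans (ler_normD _ _) _; first apply: lerD => //.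
- by rewrite normrM ip ler_wpM2r // invr_ge0; lra.
- rewrite normrM ip ler_wpM2r ?IHN ?ltn_Pdiv // invr_ge0; lra.
Qed.

(** * The character mod 4 and its twists *)

Lemma alternating_sum_bounds c :
  (forall n, 0 <= c n.+1 <= c n) ->
  forall n, 0 <= \sum_(0 <= i < n) (-1) ^+ i * c i <= c 0%N.
Proof.
move=> cP; have c0 n : 0 <= c n by have := cP n; lra.
pose T n := \sum_(0 <= i < n) (-1) ^+ i * c i.
(* Two consecutive partial sums are bounded together, because the next one lies between them. *)
suff H n : (0 <= T n <= c 0%N) && (0 <= T n.+1 <= c 0%N).
  by move=> n; have /andP[] := H n.
have TS m : T m.+1 = T m + (-1) ^+ m * c m by rewrite /T big_nat_recr.
elim: n => [|n /andP[IH1 IH2]].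
  by rewrite TS /T big_geq // expr0 mul1r add0r !lexx !c0.
rewrite IH2 /=; move: IH1 IH2; rewrite (TS n.+1) (TS n) exprS.
by have := cP n; rewrite -signr_odd; case: (odd n); rewrite ?expr0 ?expr1; lra.
Qed.

(* The nonprincipal character mod 4 with its sign at each prime of Q (a
   duplicate-free list of primes) reversed. *)
Fixpoint character Q n : R :=
  if Q is p :: Q' then (-1) ^+ logn p n * character Q' n
  else if odd n then (-1) ^+ n./2 else 0.

Lemma characterM Q m n : (0 < m)%N -> (0 < n)%N ->
  character Q (m * n) = character Q m * character Q n.
Proof.
move=> m_gt0 n_gt0; elim: Q => [|p Q IHQ] /=; last first.
  by rewrite lognM // exprD IHQ; ring.
rewrite oddM; case: (boolP (odd m)) => om /=; last by rewrite mul0r.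
case: (boolP (odd n)) => on /=; last by rewrite mulr0.
rewrite -exprD -signr_odd -[in RHS]signr_odd; congr (_ ^+ nat_of_bool _).
(* With m = 2a + 1 and n = 2b + 1, the half of mn is 2ab + a + b, which has the parity of a + b. *)
have -> : (m * n)./2 = (2 * (m./2 * n./2) + (m./2 + n./2))%N.
  have := odd_double_half m; have := odd_double_half n.
  rewrite om on -!muln2 => nE mE; rewrite -{1}nE -{1}mE; nia.
by rewrite oddD oddM.
Qed.

(** For odd p, [p./2] is odd exactly when p = 3 mod 4. As [Q] lists distinct primes, only the entry
    p itself, occurring at most once, changes the sign. *)
Lemma character_prime Q p : uniq Q -> all prime Q -> prime p -> odd p ->
  character Q p = (-1) ^+ (odd p./2 (+) (p \in Q)).
Proof.
move=> + + p_pr p_odd; elim: Q => [|q Q IHQ] /=.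
  by rewrite p_odd addbF signr_odd.
case/andP=> qQ uQ /andP[q_pr prQ]; rewrite IHQ // logn_prime // inE.
case: (eqVneq q p) => [<-|qp] /=.
  by rewrite (negPf qQ) addbF addbT signrN mulN1r.
by rewrite mul1r.
Qed.

(** These are the partial sums of the Leibniz series 1 - 1/3 + 1/5 - ... *)
Lemma character0_bound N : `|harmonic_sum (character [::]) N| <= 1.
Proof.
have -> : harmonic_sum (character [::]) N =
    \sum_(0 <= i < uphalf N) (-1) ^+ i * (2 * i + 1)%:R^-1.
  rewrite /harmonic_sum; elim: N => [|N IHN]; first by rewrite !big_geq.
  rewrite big_nat_recr //= IHN.
  case oN: (odd N) => /=; rewrite uphalf_half oN /= ?mul0r ?addr0 ?add1n //.
  rewrite [in RHS]big_nat_recr //= add0n; congr (_ + _ / _%:R); lia.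
have := @alternating_sum_bounds (fun i => (2 * i + 1)%:R^-1) _ (uphalf N).
rewrite invr1 ler_norml => H.
suff /H : forall n, 0 <= (((2 * n.+1 + 1)%:R)^-1 : R) <= (2 * n + 1)%:R^-1 by lra.
by move=> n; rewrite invr_ge0 ler0n /= lef_pV2 ?posrE ?ltr0n ?addn1 // ler_nat; lia.
Qed.

Lemma coprime_prodn p Q : prime p -> all prime Q -> p \notin Q ->
  coprime p (\prod_(q <- Q) q).
Proof.
move=> p_pr; elim: Q => [|q Q IHQ]; first by rewrite big_nil coprimen1.
rewrite big_cons coprimeMr inE negb_or /= => /andP[q_pr prQ] /andP[pq pQ].
by rewrite IHQ // andbT prime_coprime // dvdn_prime2.
Qed.

(** Adding p to [Q] changes the value at p from -1 to 1, so [harmonic_sum_twist] applies; its factor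
    p/(p-1) is p/phi(p), and phi is multiplicative on coprime factors. *)
Lemma character_bound Q N : uniq Q ->
  all (fun p => prime p && (p %% 4 == 3)%N) Q ->
  `|harmonic_sum (character Q) N| <=
    ((\prod_(p <- Q) p)%N%:R / (totient (\prod_(p <- Q) p))%:R) ^+ 2.
Proof.
move=> + +; elim: Q N => [|p Q IHQ] N.
  by rewrite big_nil divr1 expr1n => _ _; exact: character0_bound.
case/andP=> pQ uQ /andP[/andP[p_pr /eqP p3] allQ].
have prQ : all prime Q by apply: sub_all allQ => q /andP[].
have p_odd : odd p by lia.
have chip : character Q p = -1.
  by rewrite character_prime // (negPf pQ) addbF; have -> : odd p./2 by lia.
have p_gt0 := prime_gt0 p_pr.
rewrite big_cons totient_coprime ?coprime_prodn // totient_prime //.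
rewrite !natrM invfM mulrACA exprMn mulrC.
apply: (@harmonic_sum_twist (character Q)) => //; first exact: prime_gt1.
- by move=> n pn /=; rewrite lognE (negPf pn) !andbF mul1r.
- by move=> n n_gt0; rewrite characterM // chip mulN1r.
- move=> n n_gt0; rewrite characterM //= chip.
  by rewrite logn_prime // eqxx; ring.
- by move=> M; apply: IHQ.
Qed.

(** Every prime factor of n has value 1: those that are 1 mod 4 are left alone, those that are 3 mod
    4 are flipped. Multiplicativity does the rest. *)
Lemma character_eq1 Q y n : uniq Q -> all prime Q ->
  (forall p, prime p -> (p <= y)%N -> (p %% 4 = 3)%N -> p \in Q) ->
  (forall p, p \in Q -> (p %% 4 = 3)%N) ->
  (n <= y)%N -> odd n -> character Q n = 1.
Proof.
move=> uQ prQ Qin Q3; elim/ltn_ind: n => n IHn ny on.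
case: (ltngtP n 1%N) => [|n_gt1|->]; first by case: n on {IHn ny}.
- have p_pr := pdiv_prime n_gt1; have /dvdnP[m nE] := pdiv_dvd n.
  set p := pdiv n in p_pr nE.
  have p_gt1 := prime_gt1 p_pr.
  have m_gt0 : (0 < m)%N by lia.
  have [om op] : odd m /\ odd p by apply/andP; rewrite -oddM -nE.
  have mn : (m < n)%N by rewrite nE ltn_Pmulr.
  have py : (p <= y)%N by apply: leq_trans ny; rewrite nE leq_pmull.
  have p_gt0 := prime_gt0 p_pr.
  rewrite nE characterM // IHn // ?(leq_trans (ltnW mn)) // mul1r.
  rewrite character_prime //; case: (boolP (p \in Q)) => [/Q3 p3|pQ].
    by have -> : odd p./2 by lia.
  suff -> : odd p./2 = false by [].
  have [p3|p3] := eqVneq (p %% 4)%N 3%N; last by lia.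
  by rewrite (Qin p) in pQ.
- elim: Q uQ prQ {Qin Q3 IHn} => [|q Q IHQ] //= /andP[_ uQ] /andP[_ prQ].
  by rewrite logn1 mul1r IHQ.
Qed.

(** * Making phi(P)/P small *)

(** Since 1/(j+1) <= 2/(2j+1), a bound here would make the harmonic series converge. *)
Lemma odd_harmonic_unbounded (A : R) :
  exists m, A <= \sum_(0 <= j < m) (2 * j + 1)%:R^-1.
Proof.
apply: contrapT => noM; apply: (@dvg_harmonic R).
have h0 j : 0 <= (j.+1%:R : R)^-1 by rewrite invr_ge0.
apply: nondecreasing_is_cvgn.
  by apply: nondecreasing_series => j _ _; exact: h0.
exists (2 * A) => _ [m _ <-].
have [Am|] := leP A (\sum_(0 <= j < m) (2 * j + 1)%:R^-1).
  by case: noM; exists m.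
move=> /ltW; rewrite -(ler_pM2l (_ : 0 < 2)) //; apply: le_trans.
rewrite /series /= mulr_sumr; apply: ler_sum => j _.
rewrite -[leLHS]mulr1 mulrC ler_pdivlMr ?ltr0n ?addn1 //.
rewrite mul1r mulrC ler_pdivrMr ?ltr0n // -natrM ler_nat; lia.
Qed.

Lemma totient_ratio_small (e : R) : 0 < e -> exists P : nat,
  [/\ (0 < P)%N, (totient P)%:R <= e * P%:R &
      forall p, prime p -> (p %| P)%N -> (p %% 4 = 3)%N].
Proof.
move=> e_gt0.
(* The square matches that in [character_bound]. With y = 2m, the odd integers up to y are the 2j +
   1 with j < m. *)
have [m mP] : exists m, e^-1 ^+ 2 <= \sum_(0 <= j < m) (2 * j + 1)%:R^-1 :> R.
  by have [m mP] := odd_harmonic_unbounded (e^-1 ^+ 2); exists m.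
pose y := m.*2.
pose Q := [seq p <- iota 0 y.+1 | prime p && (p %% 4 == 3)%N].
have uQ : uniq Q by rewrite filter_uniq ?iota_uniq.
have allQ : all (fun p => prime p && (p %% 4 == 3)%N) Q by exact: filter_all.
have prQ : all prime Q by apply: sub_all allQ => q /andP[].
have Qin p : prime p -> (p <= y)%N -> (p %% 4 = 3)%N -> p \in Q.
  by move=> p_pr py p3; rewrite mem_filter p_pr p3 eqxx mem_iota /=; lia.
have Q3 p : p \in Q -> (p %% 4 = 3)%N.
  by rewrite mem_filter => /andP[/andP[_ /eqP]].
pose P := (\prod_(p <- Q) p)%N.
have P_gt0 : (0 < P)%N.
  rewrite /P big_seq prodn_cond_gt0 // => p.
  by rewrite mem_filter => /andP[/andP[/prime_gt0]].
exists P; split=> //; last first.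
  move=> p p_pr pP; apply: Q3; apply/negPn/negP => pQ.
  by have := coprime_prodn p_pr prQ pQ; rewrite prime_coprime // pP.
have := @character_bound Q y uQ allQ; rewrite -/P.
have -> : harmonic_sum (character Q) y = \sum_(0 <= j < m) (2 * j + 1)%:R^-1.
  have chi1 n : (n <= y)%N -> character Q n = (odd n)%:R.
    move=> ny; case: (boolP (odd n)) => on; first exact: character_eq1 ny on.
    by elim: Q {uQ prQ Qin Q3 allQ P P_gt0} => [|q Q IHQ] /=;
       rewrite ?(negPf on) ?IHQ ?mulr0.
  have {}chi1 k : (k <= m)%N ->
      harmonic_sum (character Q) k.*2 = \sum_(0 <= j < k) (2 * j + 1)%:R^-1.
    rewrite /harmonic_sum; elim: k => [|k IHk] km; first by rewrite !big_geq.
    rewrite doubleS [in RHS]big_nat_recr //= [in LHS]big_nat_recr //=.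
    rewrite [in LHS]big_nat_recr //= IHk ?(ltnW km) // !chi1 /y; [|lia|lia].
    rewrite /= odd_double /= mul0r addr0 mul1r; congr (_ + _%:R^-1); lia.
  exact: chi1.
set S := \sum_(_ <= _ < _) _ in mP *; set t := totient P => PS.
have t_gt0 : 0 < t%:R :> R by rewrite ltr0n totient_gt0.
have : e^-1 ^+ 2 <= (P%:R / t%:R) ^+ 2.
  by apply: le_trans mP _; apply: le_trans (ler_norm _) PS.
rewrite ler_pXn2r ?nnegrE ?invr_ge0 ?divr_ge0 ?(ltW e_gt0) ?(ltW t_gt0) //.
by rewrite ler_pdivlMr // ler_pdivrMl.
Qed.

End HarmonicTwist.

(** * Passage to natural density *)

Theorem mainTheorem7 (R : realType) :
  (fun X : R =>
     1 / X * #|` fset_set [set n : nat |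
                [/\ (2 <= n)%N, n%:R <= X & erdos_straus n]] |%:R)
    @ +oo --> (1 : R).
Proof.
apply/cvgrPdist_le => e e_gt0.
have [P [P_gt0 Psmall P3]] := totient_ratio_small (divr_gt0 e_gt0 (ltr0n R 2)).
near=> X.
set E := [set n : nat | _].
(* The deficit X - |E| is at most 1 from truncating X plus e/2 (X + 1 + P) from integers coprime to
   P; this makes the total at most e X. *)
have X_large : (e / 2)^-1 * (1 + e / 2 * (1 + P%:R)) <= X.
  by near: X; apply: nbhs_pinfty_ge; exact: num_real.
have X_gt0 : 0 < X by near: X; exact: nbhs_pinfty_gt.
pose N := Num.trunc X.
have /andP[NX XN] : N%:R <= X < N.+1%:R by rewrite truncn_itv // ltW.
have leN (n : nat) : (n%:R <= X) = (n <= N)%N by rewrite -truncn_ge_nat // ltW.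
have finE : finite_set E.
  apply: (@sub_finite_set _ _ `I_N.+1) (finite_II _).
  by move=> n [_ nX _] /=; rewrite ltnS -leN.
have cardE_le : (#|` fset_set E| <= N)%N.
  rewrite -[leqRHS](size_iota 1) -(undup_id (iota_uniq 1 N)) -card_fseq.
  apply: fsubset_leq_card; apply/fsubsetP => n.
  rewrite in_fset_set // inE => -[n_ge2 nX _].
  by rewrite leN in nX; rewrite !inE mem_iota; lia.
(* A prime factor of gcd(P, n) is 3 mod 4, so these n are solvable; n = 1 is excluded, being coprime
   to P. *)
pose s := [seq n <- iota 1 N | ~~ coprime P n].
have cardE_ge : (size s <= #|` fset_set E|)%N.
  rewrite -(undup_id (filter_uniq _ (iota_uniq 1 N) : uniq s)) -card_fseq.
  apply: fsubset_leq_card; apply/fsubsetP => n.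
  rewrite !inE mem_filter mem_iota in_fset_set // inE => /andP[nP /andP[n_gt0 nN]].
  have g_gt1 : (1 < gcdn P n)%N.
    by rewrite ltn_neqAle eq_sym nP gcdn_gt0 P_gt0.
  have := pdiv_dvd (gcdn P n); rewrite dvdn_gcd => /andP[pP pn].
  split=> /=; last exact: erdos_straus_dvd (P3 _ (pdiv_prime g_gt1) pP) pn n_gt0.
  - by case: n {nN pn pP g_gt1} nP n_gt0 => [|[|n]] //; rewrite coprimen1.
  - by rewrite leN; lia.
have size_s : (N <= size s + (N.+1 %/ P).+1 * totient P)%N.
  rewrite -{1}(size_iota 1 N) -(count_predC (coprime P)) addnC size_filter.
  rewrite leq_add2l; apply: leq_trans (count_coprime_le N.+1 P_gt0).
  by rewrite big_ltn // /index_iota subSS subn0 -sum1_count big_mkcond leq_addl.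
have : `|X - #|` fset_set E|%:R| <= e * X.
  have : N%:R <= (size s)%:R + (N.+1 %/ P).+1%:R * (totient P)%:R :> R.
    by rewrite -natrM -natrD ler_nat.
  have : (size s)%:R <= #|` fset_set E|%:R :> R by rewrite ler_nat.
  have : #|` fset_set E|%:R <= N%:R :> R by rewrite ler_nat.
  have : (N.+1 %/ P).+1%:R * (totient P)%:R <=
         e / 2 * (X + 1 + P%:R) :> R.
    apply: (@le_trans _ _ ((N.+1 %/ P).+1%:R * (e / 2 * P%:R))).
      by rewrite ler_wpM2l.
    rewrite mulrCA ler_wpM2l ?divr_ge0 ?(ltW e_gt0) // -natrM.
    apply: (@le_trans _ _ (N.+1 + P)%:R).
      by rewrite ler_nat mulSn addnC leq_add2r leq_trunc_div.
    by rewrite natrD -natr1; lra.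
  have : 1 + e / 2 * (1 + P%:R) <= e / 2 * X.
    by rewrite -ler_pdivrMl ?divr_gt0.
  have : 0 <= e * X by rewrite mulr_ge0 // ltW.
  move: XN; rewrite -natr1 ler_norml; lra.
have -> : 1 - 1 / X * #|` fset_set E|%:R = (X - #|` fset_set E|%:R) / X.
  by field; rewrite gt_eqF.
by rewrite normrM normfV (gtr0_norm X_gt0) ler_pdivrMr.
Unshelve. all: by end_near.
Qed.
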